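(* Let $T$ be an $r$-ary GDH theory, let $\mathcal{F}$ be a family of forbidden $T$-graphs, and let $\epsilon > 0$. Then there exists a $T$-graph $G$ such that every blowup $G(t)$ of $G$ (for every tuple $t$ of positive integers) is $\mathcal{F}$-free and \[\pi_T(\mathcal{F}) \geq b_T(G) > \pi_T(\mathcal{F}) - \epsilon.\]
   Context: For an integer $r \geq 2$ and a subgroup $J_T \subseteq S_r$, the GDH theory $T$ has $m_T := |J_T|$. A $T$-graph $G$ is a finite set $V_G$ with a relation $E_G \subseteq V_G^r$ such that every tuple in $E_G$ has pairwise distinct entries and $E_G$ is closed under permuting coordinates by elements of $J_T$. An edge is an orbit of $E_G$ under this $J_T$-action. A copy of $H$ in $G$ is an injective map $V_H \to V_G$ sending every tuple of $E_H$ to a tuple of $E_G$; $G$ is $\mathcal{F}$-free if it contains no copy of any member of $\mathcal{F}$. $\text{ex}_T(n,\mathcal{F})$ is the maximum number of edges in an $\mathcal{F}$-free $T$-graph on $n$ vertices and $\pi_T(\mathcal{F}) = \lim_{n\to\infty} \text{ex}_T(n,\mathcal{F})/\left(\frac{r!}{m_T}\binom{n}{r}\right)$. For $G$ with $V_G = \{x_1,\ldots,x_n\}$ and positive integers $t = (t_1,\ldots,t_n)$, the $t$-blowup $G(t)$ has vertex set $\{x_{ij}: 1 \le i \le n, 1 \le j \le t_i\}$ and $(x_{i_1j_1},\ldots,x_{i_rj_r}) \in E_{G(t)}$ iff $(x_{i_1},\ldots,x_{i_r}) \in E_G$. For an $r$-subset $R$ of $V_G$, let $e_R$ be the number of edges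 whose entries form the set $R$; the edge polynomial is $p_G(x) = \sum_R e_R \prod_{i\in R} x_i$ and the blowup density is $b_T(G) = m_T \max\{p_G(x): x_i \geq 0, \sum_i x_i = 1\}$. *)

(* Defs.v *)
From HB Require Import structures.
From mathcomp Require Import all_boot all_order all_algebra all_fingroup.
From mathcomp Require Import boolp classical_sets reals topology normedtype sequences.

Set Implicit Arguments.
Unset Strict Implicit.
Unset Printing Implicit Defensive.

Import Order.TTheory GRing.Theory Num.Theory.
Import numFieldNormedType.Exports.

Local Open Scope ring_scope.

(* r-tuples of elements of V are finite functions 'I_r -> V; this is
   (x_1, ..., x_r) |-> (x_(s 1), ..., x_(s r)). *)
Definition permute (r : nat) (V : finType) (s : 'S_r) (x : {ffun 'I_r -> V}) :
  {ffun 'I_r -> V} := [ffun i => x (s i)].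

Definition is_tgraph (r : nat) (J : {group 'S_r}) (V : finType)
    (E : {set {ffun 'I_r -> V}}) : bool :=
  [forall x in E, injectiveb x && [forall s in J, permute s x \in E]].

Record tgraph (r : nat) (J : {group 'S_r}) (V : finType) := TGraph {
  erel : {set {ffun 'I_r -> V}};
  erelP : is_tgraph J erel }.

HB.instance Definition _ (r : nat) (J : {group 'S_r}) (V : finType) :=
  [isSub for @erel r J V].
HB.instance Definition _ (r : nat) (J : {group 'S_r}) (V : finType) :=
  [Finite of tgraph J V by <:].

Definition edges (r : nat) (J : {group 'S_r}) (V : finType) (G : tgraph J V) :
    {set {set {ffun 'I_r -> V}}} :=
  [set [set permute s x | s in J] | x in erel G].

Definition has_copy (r : nat) (J : {group 'S_r}) (W V : finType)
    (H : tgraph J W) (G : tgraph J V) : Prop :=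
  exists f : W -> V, injective f /\
    forall x, x \in erel H -> [ffun i => f (x i)] \in erel G.

(* A family of T-graphs is an arbitrary class of them, possibly infinite. *)
Definition tfamily (r : nat) (J : {group 'S_r}) : Type :=
  forall V : finType, tgraph J V -> Prop.

Definition tfree (r : nat) (J : {group 'S_r}) (F : tfamily J) (V : finType)
    (G : tgraph J V) : Prop :=
  forall (W : finType) (H : tgraph J W), F W H -> ~ has_copy H G.

(* Up to isomorphism the T-graphs on n vertices are those on 'I_n.  The maximum
   of an empty range is 0 by convention. *)
Definition ex_T (r : nat) (J : {group 'S_r}) (F : tfamily J) (n : nat) : nat :=
  \max_(G : tgraph J 'I_n | `[< tfree F G >]) #|edges G|.

Definition pi_T (R : realType) (r : nat) (J : {group 'S_r}) (F : tfamily J) : R :=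
  limn (fun n : nat =>
    (ex_T F n)%:R / ((r`!)%:R / #|J|%:R * 'C(n, r)%:R) : R).

Section Blowup.
Variables (r : nat) (J : {group 'S_r}) (V : finType) (G : tgraph J V).
Variable t : V -> nat.

Definition blowup_rel : {set {ffun 'I_r -> {v : V & 'I_(t v)}}} :=
  [set z : {ffun 'I_r -> {v : V & 'I_(t v)}} | [ffun i => tag (z i)] \in erel G].

Lemma blowup_relP : is_tgraph J blowup_rel.
Proof.
apply/forall_inP => z; rewrite inE => zE.
have /andP[/injectiveP zi /forall_inP zJ] := forall_inP (erelP G) _ zE.
apply/andP; split.
  by apply/injectiveP => i j zij; apply: zi; rewrite !ffunE zij.
apply/forall_inP => s sJ; rewrite inE.
have -> : [ffun i => tag (permute s z i)] = permute s [ffun i => tag (z i)].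
  by apply/ffunP => i; rewrite !ffunE.
exact: zJ.
Qed.

Definition blowup : tgraph J {v : V & 'I_(t v)} := TGraph blowup_relP.

End Blowup.

(* All tuples in the orbit e have the same set of entries. *)
Definition entries (r : nat) (V : finType) (e : {set {ffun 'I_r -> V}}) : {set V} :=
  \bigcup_(x in e) [set x i | i : 'I_r].

Definition edge_count (r : nat) (J : {group 'S_r}) (V : finType)
    (G : tgraph J V) (A : {set V}) : nat :=
  #|[set e in edges G | entries e == A]|.

Definition edge_poly (R : realType) (r : nat) (J : {group 'S_r}) (V : finType)
    (G : tgraph J V) (x : V -> R) : R :=
  \sum_(A : {set V} | #|A| == r) (edge_count G A)%:R * \prod_(v in A) x v.

Definition simplex (R : realType) (V : finType) : set (V -> R) :=
  [set x : V -> R | (forall v, 0 <= x v) /\ \sum_v x v = 1]%classic.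

(* For nonempty V this supremum is a maximum, the simplex being compact. *)
Definition b_T (R : realType) (r : nat) (J : {group 'S_r}) (V : finType)
    (G : tgraph J V) : R :=
  #|J|%:R * sup [set edge_poly G x | x in @simplex R V]%classic.

(* Main.v *)
(* By double counting, |E_G| = m_T * (number of edges), so all densities are
   measured in tuples; m_T * p_G(x) is then the probability that r independent
   x-distributed vertices form a tuple of E_G.  For f : U -> V the pullback f^*G
   is a subgraph of a blowup of G.  Hence, if all blowups of G are F-free, a
   random pullback along f : [n] -> V_G shows m_T * p_G(x) <= ex-density(n) for
   every n, which gives b_T(G) <= pi_T(F).
   For the lower bound take an almost extremal F-free G_N on N >> n vertices.  If
   a T-graph H on [n] has a blowup that is not F-free, then injective f with
   f^*G_N = H are rare: otherwise Erdős' box theorem would give large disjoint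
   sets S_1, ..., S_n such that f^*G_N = H for all f in the product of the S_i,
   that is, a copy of every bounded blowup of H in G_N.  So almost all pullbacks
   to [n] have only F-free blowups, while their average density is about
   pi_T(F). *)

Require Import Defs.
From HB Require Import structures.
From mathcomp Require Import all_boot all_order all_algebra all_fingroup.
From mathcomp Require Import boolp classical_sets reals topology normedtype sequences.
From mathcomp Require Import zify ring lra.

Set Implicit Arguments.
Unset Strict Implicit.
Unset Printing Implicit Defensive.

Import Order.TTheory GRing.Theory Num.Theory.
Import numFieldNormedType.Exports.

Local Open Scope ring_scope.

(** * Orbits, counting in tuples, and pullbacks *)

Section Tuples.
Variables (r : nat) (J : {group 'S_r}).
Implicit Types (V W U : finType).

Definition compose V W (f : V -> W) (z : {ffun 'I_r -> V}) : {ffun 'I_r -> W} :=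
  [ffun i => f (z i)].

Definition orb V (z : {ffun 'I_r -> V}) : {set {ffun 'I_r -> V}} :=
  [set permute s z | s in J].

Definition tuple_poly (R : realType) V (G : tgraph J V) (x : V -> R) : R :=
  \sum_(z in erel G) \prod_i x (z i).

Lemma erel_inj V (G : tgraph J V) z : z \in erel G -> injective z.
Proof. by move=> /(forall_inP (erelP G))/andP[/injectiveP]. Qed.

Lemma erel_permute V (G : tgraph J V) z s :
  z \in erel G -> s \in J -> permute s z \in erel G.
Proof. by move=> /(forall_inP (erelP G))/andP[_ /forall_inP]; apply. Qed.

Lemma permuteM V (s t : 'S_r) (z : {ffun 'I_r -> V}) :
  permute s (permute t z) = permute (s * t)%g z.
Proof. by apply/ffunP => i; rewrite !ffunE permM. Qed.

Lemma permute1 V (z : {ffun 'I_r -> V}) : permute 1%g z = z.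
Proof. by apply/ffunP => i; rewrite !ffunE perm1. Qed.

Lemma mem_orb V (z : {ffun 'I_r -> V}) : z \in orb z.
Proof. by apply/imsetP; exists 1%g; rewrite ?group1 ?permute1. Qed.

Lemma orb_permute V (s : 'S_r) (z : {ffun 'I_r -> V}) :
  s \in J -> orb (permute s z) = orb z.
Proof.
move=> sJ; apply/setP => y; apply/imsetP/imsetP => -[t tJ ->].
  by exists (t * s)%g; rewrite ?groupM ?permuteM.
exists (t * s^-1)%g; first by rewrite groupM ?groupV.
by rewrite permuteM mulgKV.
Qed.

Lemma orb_fiber V (G : tgraph J V) y :
  y \in erel G -> [set z in erel G | orb z == orb y] = orb y.
Proof.
move=> yE; apply/setP => z; rewrite inE; apply/andP/idP => [[_ /eqP <-]|].
  exact: mem_orb.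
by case/imsetP => s sJ ->; rewrite orb_permute// erel_permute.
Qed.

(** Permutations act freely on injective tuples. *)
Lemma card_orb V (y : {ffun 'I_r -> V}) : injective y -> #|orb y| = #|J|.
Proof.
move=> yi; rewrite card_imset// => s t /ffunP st.
by apply/permP => i; move: (st i); rewrite !ffunE => /yi.
Qed.

Lemma sum_erel_edges (R : realType) V (G : tgraph J V)
    (h : {set {ffun 'I_r -> V}} -> R) :
  \sum_(z in erel G) h (orb z) = #|J|%:R * \sum_(e in edges G) h e.
Proof.
rewrite (partition_big_imset (@orb V)) big_distrr/=.
apply: eq_bigr => _ /imsetP[y yE ->].
rewrite (eq_bigr (fun=> h (orb y))); last by move=> z /andP[_ /eqP ->].
rewrite sumr_const [RHS]mulr_natl; congr (_ *+ _).
rewrite -(card_orb (erel_inj yE)) -[in RHS](orb_fiber yE).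
by apply: eq_card => z; rewrite !inE.
Qed.

Lemma card_erel V (G : tgraph J V) : #|erel G| = (#|J| * #|edges G|)%N.
Proof.
rewrite -sum1_card (partition_big_imset (@orb V))/= -/(edges G) mulnC -sum_nat_const.
apply: eq_bigr => _ /imsetP[y yE ->].
rewrite sum1dep_card -(card_orb (erel_inj yE)) -[in RHS](orb_fiber yE).
by apply: eq_card => z; rewrite !inE.
Qed.

Lemma entries_orb V (z : {ffun 'I_r -> V}) :
  entries (orb z) = [set z i | i : 'I_r].
Proof.
apply/setP => v; apply/bigcupP/imsetP.
  by case=> _ /imsetP[s sJ ->] /imsetP[i _ ->]; exists (s i); rewrite ?ffunE.
by case=> i _ ->; exists z; rewrite ?mem_orb// imset_f.
Qed.

(** An injective [z] lists each element of [entries (orb z)] once, so its monomial depends only on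
    its edge; edges are then grouped by vertex set. *)
Lemma tuple_polyE (R : realType) V (G : tgraph J V) (x : V -> R) :
  tuple_poly G x = #|J|%:R * edge_poly G x.
Proof.
rewrite /tuple_poly /edge_poly.
rewrite (eq_bigr (fun z => \prod_(v in entries (orb z)) x v)); last first.
  move=> z zE; rewrite entries_orb big_imset//=.
  by move=> i j _ _; apply: (erel_inj zE).
rewrite (sum_erel_edges G (fun e => \prod_(v in entries e) x v)).
congr (_ * _); rewrite (partition_big (fun e => entries e)
  (fun A : {set V} => #|A| == r))/=; last first.
  move=> _ /imsetP[z zE ->]; rewrite entries_orb card_imset ?card_ord//.
  exact: erel_inj zE.
apply: eq_bigr => A _; rewrite /edge_count.
rewrite -sum1_card natr_sum big_distrl/=.
apply: eq_big => [e|e /andP[_ /eqP ->]]; first by rewrite inE.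
by rewrite mul1r.
Qed.

Lemma pullback_is_tgraph V U (f : U -> V) (G : tgraph J V) :
  is_tgraph J [set z | compose f z \in erel G].
Proof.
apply/forall_inP => z; rewrite inE => zE; apply/andP; split.
  by apply/injectiveP => i j zij; apply: (erel_inj zE); rewrite !ffunE zij.
apply/forall_inP => s sJ; rewrite inE.
suff -> : compose f (permute s z) = permute s (compose f z) by apply: erel_permute.
by apply/ffunP => i; rewrite !ffunE.
Qed.

(** For non-injective [f], vertices with the same image share no edge, like clones in a blowup. *)
Definition pullback V U (f : U -> V) (G : tgraph J V) : tgraph J U :=
  TGraph (pullback_is_tgraph f G).

Lemma in_pullback V U (f : U -> V) (G : tgraph J V) z :
  (z \in erel (pullback f G)) = (compose f z \in erel G).
Proof. by rewrite inE. Qed.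

Lemma has_copy_trans V W U (H : tgraph J V) (G : tgraph J W) (K : tgraph J U) :
  has_copy H G -> has_copy G K -> has_copy H K.
Proof.
move=> [f [fi fE]] [g [gi gE]]; exists (g \o f); split; first exact: inj_comp.
move=> x /fE/gE; suff -> : [ffun i => g ([ffun i => f (x i)] i)] =
  [ffun i => (g \o f) (x i)] by [].
by apply/ffunP => i; rewrite !ffunE.
Qed.

Lemma tfree_copy (F : tfamily J) V W (G : tgraph J V) (K : tgraph J W) :
  has_copy G K -> tfree F K -> tfree F G.
Proof. by move=> GK KF U H HF HG; apply: (KF _ _ HF); apply: has_copy_trans GK. Qed.

Lemma pullback_copy V U (f : U -> V) (G : tgraph J V) :
  injective f -> has_copy (pullback f G) G.
Proof. by move=> fi; exists f; split=> // x; rewrite in_pullback. Qed.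

Lemma pullback_blowup_copy V U (f : U -> V) (G : tgraph J V) :
  has_copy (pullback f G) (blowup G (fun=> #|U|)).
Proof.
(* Distinct ranks make the map injective even where [f] is not. *)
exists (fun u => existT (fun v : V => 'I_#|U|) (f u) (enum_rank u)); split.
  move=> u u' /(congr1 (fun p : {v : V & 'I_#|U|} => nat_of_ord (projT2 p)))/=.
  by move/ord_inj/enum_rank_inj.
move=> z; rewrite in_pullback inE; set y := [ffun i => tag _].
by have -> : y = compose f z by apply/ffunP => i; rewrite !ffunE.
Qed.

Lemma card_erel_le V (G : tgraph J V) : (#|erel G| <= #|V| ^_ r)%N.
Proof.
rewrite -[X in (_ ^_ X)%N](card_ord r) -card_inj_ffuns.
by apply/subset_leq_card/fintype.subsetP => z /erel_inj zi; rewrite inE; apply/injectiveP.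
Qed.

Lemma card_erel_ex (F : tfamily J) n (G : tgraph J 'I_n) :
  tfree F G -> (#|erel G| <= #|J| * ex_T F n)%N.
Proof.
move=> GF; rewrite card_erel leq_mul2l; apply/orP; right.
by apply: (@leq_bigmax_cond _ _ (fun G : tgraph J 'I_n => #|edges G|)); apply/asboolP.
Qed.

Lemma ex_T_attained (F : tfamily J) n : (exists G : tgraph J 'I_n, tfree F G) ->
  exists2 G : tgraph J 'I_n, tfree F G & #|erel G| = (#|J| * ex_T F n)%N.
Proof.
move=> [G0 G0F].
have [|G GF GE] := @eq_bigmax_cond _ (fun G : tgraph J 'I_n => `[< tfree F G >])
  (fun G : tgraph J 'I_n => #|edges G|).
  by apply/card_gt0P; exists G0; rewrite unfold_in; apply/asboolP.
exists G; [exact/asboolP | by rewrite card_erel -GE].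
Qed.

End Tuples.

(** * Random maps with independent values of law [x] *)

Section Sampling.
Variables (R : realType) (r : nat) (J : {group 'S_r}).

Lemma sum_prod1 (I V : finType) (x : V -> R) : \sum_v x v = 1 ->
  \sum_(f : {ffun I -> V}) \prod_j x (f j) = 1.
Proof.
by move=> x1; rewrite -(bigA_distr_bigA (fun (_ : I) v => x v)) big1.
Qed.

(** With [x] read as a distribution: the values of [f] at the distinct points [z i] are independent
    with law [x]. *)
Lemma sum_prod_fiber (n : nat) (V : finType) (x : V -> R)
    (z : {ffun 'I_r -> 'I_n}) (y : {ffun 'I_r -> V}) :
  \sum_v x v = 1 -> injective z ->
  \sum_(f : {ffun 'I_n -> V} | compose f z == y) \prod_j x (f j) = \prod_i x (y i).
Proof.
move=> x1 zi.
(* [Q] splits [compose f z = y] into one condition per coordinate, so the sum factorizes;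
   coordinates outside the image of [z] contribute the total mass 1. *)
pose Q j v := [forall i, (z i == j) ==> (v == y i)].
rewrite (eq_bigl (fun f : {ffun 'I_n -> V} => f \in family Q)); last first.
  move=> f; apply/eqP/familyP => [yE j|fQ].
    by apply/forallP => i; apply/implyP => /eqP <-; rewrite -yE ffunE.
  apply/ffunP => i; rewrite ffunE.
  by have /forallP/(_ i) := fQ (z i); rewrite eqxx => /eqP.
rewrite -(bigA_distr_big_dep _ (fun (_ : 'I_n) v => x v)).
rewrite (bigID [in [set z i | i : 'I_r]])/= [X in _ * X]big1 ?mulr1; last first.
  move=> j /imsetP jz; rewrite -x1; apply: eq_bigl => v.
  by apply/forallP => i; apply/implyP => /eqP zij; case: jz; exists i.
rewrite big_imset/=; last by move=> i j _ _ /zi.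
apply: eq_bigr => i _; rewrite (big_pred1 (y i))// => v.
apply/forallP/eqP => [/(_ i)|-> k]; first by rewrite eqxx => /eqP.
by apply/implyP => /eqP/zi ->.
Qed.

(** Linearity of expectation: each of the [n ^_ r] injective tuples lies in the random pullback with
    probability [tuple_poly G x]. *)
Lemma sum_pullback (n : nat) (V : finType) (G : tgraph J V) (x : V -> R) :
  \sum_v x v = 1 ->
  \sum_(f : {ffun 'I_n -> V}) (\prod_j x (f j)) * #|erel (pullback f G)|%:R
    = (n ^_ r)%:R * tuple_poly G x.
Proof.
move=> x1.
transitivity (\sum_(z : {ffun 'I_r -> 'I_n} | injectiveb z) tuple_poly G x);
  last first.
  rewrite sumr_const mulr_natl; congr (_ *+ _).
  rewrite -[X in (_ ^_ X)%N](card_ord r) -[in RHS](card_ord n) -card_inj_ffuns.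
  by apply: eq_card => z; rewrite !inE.
pose w (f : {ffun 'I_n -> V}) := \prod_j x (f j).
transitivity (\sum_(f : {ffun 'I_n -> V}) \sum_(z : {ffun 'I_r -> 'I_n} |
    injectiveb z) w f * (compose f z \in erel G)%:R).
  apply: eq_bigr => f _; rewrite -big_distrr -sum1_card natr_sum/=; congr (_ * _).
  rewrite [RHS](bigID [in erel (pullback f G)])/= [X in _ + X]big1 ?addr0.
    apply: eq_big => z; last by rewrite in_pullback => ->.
    have /= := @erel_inj _ _ _ (pullback f G) z.
    by case: (z \in _) => [/(_ isT)/injectiveP ->|]; rewrite ?andbF.
  by move=> z /andP[_]; rewrite in_pullback => /negbTE ->.
rewrite exchange_big; apply: eq_bigr => z /injectiveP zi /=.
rewrite (partition_big (fun f : {ffun _ -> _} => compose f z) xpredT)//=.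
rewrite /tuple_poly [RHS]big_mkcond/=; apply: eq_bigr => y _.
rewrite -(sum_prod_fiber y x1 zi).
case: ifPn => yE; last by rewrite big1// => f /eqP ->; rewrite (negbTE yE) mulr0.
by apply: eq_bigr => f /eqP ->; rewrite yE mulr1.
Qed.

End Sampling.

(** * Erdős's box theorem and the estimates behind it *)

Section BoxLemma.
Variable R : realType.

(** Convexity: the power function lies above its tangent at [b]. *)
Lemma tangent_pow (a b : R) k : 0 <= a -> 0 <= b ->
  k.+1%:R * b ^+ k * a <= a ^+ k.+1 + k%:R * b ^+ k.+1.
Proof.
move=> a0 b0; elim: k => [|k IH]; first by rewrite !expr1 expr0 mul0r addr0 mulr1 mul1r.
have h1 : a * (k.+1%:R * b ^+ k * a) <= a * (a ^+ k.+1 + k%:R * b ^+ k.+1).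
  exact: ler_wpM2l.
(* This term is exactly the gap between [a] times the inequality for [k] and the inequality for
   [k.+1]. *)
have h2 : 0 <= k.+1%:R * b ^+ k * (a - b) ^+ 2.
  by rewrite mulr_ge0 ?sqr_ge0// mulr_ge0// exprn_ge0.
move: h1; rewrite -subr_ge0 => h1; rewrite -subr_ge0.
apply: le_trans (addr_ge0 h1 h2) _; rewrite le_eqVlt; apply/orP; left; apply/eqP.
by rewrite !exprS -!natr1; ring.
Qed.

(** The tangent inequalities at [b], a lower bound for the mean, are summed over [t]. *)
Lemma power_mean (T : finType) (a : T -> R) (b : R) k :
  (forall t, 0 <= a t) -> 0 <= b -> b * #|T|%:R <= \sum_t a t ->
  b ^+ k.+1 * #|T|%:R <= \sum_t a t ^+ k.+1.
Proof.
move=> a0 b0 ab.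
have : k.+1%:R * b ^+ k * \sum_t a t <=
    \sum_t a t ^+ k.+1 + k%:R * b ^+ k.+1 * #|T|%:R.
  rewrite mulr_natr -sumr_const -big_split/= big_distrr/=.
  by apply: ler_sum => t _; exact: tangent_pow.
have : k.+1%:R * b ^+ k * (b * #|T|%:R) <= k.+1%:R * b ^+ k * \sum_t a t.
  by apply: ler_wpM2l => //; rewrite mulr_ge0// exprn_ge0.
rewrite exprS -natr1.
move: (b ^+ k) (k%:R) (#|T|%:R) (\sum_t a t) (\sum_t a t ^+ _) => B K N S1 S2.
lra.
Qed.

Lemma ffact_le_expn (N s : nat) : (N ^_ s <= N ^ s)%N.
Proof.
by rewrite -[N in (N ^_ _)%N](card_ord N) -[s in (_ ^_ s)%N](card_ord s)
  -[in leqRHS](card_ord N) -[s in leqRHS](card_ord s)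
  -card_ffun -card_inj_ffuns max_card.
Qed.

(** At most a fraction [s ^ 2 / N] of the maps from [s] to [N] points is not injective; multiplying
    by [N] keeps this in [nat]. *)
Lemma expn_ffact (N s : nat) : (N ^ s * N <= N ^_ s * N + s ^ 2 * N ^ s)%N.
Proof.
elim: s => [|s IH]; first by rewrite !expn0 ffactn0 leq_addr.
have ff := ffact_le_expn N s.
rewrite ffactnSr !expnS !mulnA.
have h : (N <= (N - s) + s)%N by lia.
have h2 : (N ^_ s * N * N <= N ^_ s * N * ((N - s) + s))%N by rewrite leq_mul2l h orbT.
have h3 : (N ^_ s * N * s <= N ^ s * N * s)%N by rewrite !leq_mul2r ff !orbT.
have h4 : (N * (N ^ s * N) <= N * (N ^_ s * N + s ^ 2 * N ^ s))%N
  by rewrite leq_mul2l IH orbT.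
nia.
Qed.

Lemma ffact_lower (N s : nat) (d : R) : 0 < d -> s%:R ^+ 2 <= d * N%:R ->
  (1 - d) * N%:R ^+ s <= (N ^_ s)%:R.
Proof.
move=> d0 sN; have [->|N0] := posnP N.
  case: s sN => [|s] _; last by rewrite expr0n mulr0.
  by rewrite expr0 mulr1 ffactn0 lerBlDr lerDl ltW.
have := expn_ffact N s; rewrite -(ler_nat R) natrD !natrM !natrX => h.
rewrite -(ler_pM2r (_ : 0 < N%:R)) ?ltr0n//.
have : s%:R ^+ 2 * N%:R ^+ s <= d * N%:R * N%:R ^+ s.
  by apply: ler_wpM2r => //; rewrite exprn_ge0.
move: h; move: (N%:R ^+ s) (N ^_ s)%:R => A B; lra.
Qed.

Lemma ffact_near (s : nat) (d : R) : 0 < d -> exists2 N0 : nat, (0 < N0)%N &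
  forall N, (N0 <= N)%N -> (1 - d) * N%:R ^+ s <= (N ^_ s)%:R.
Proof.
move=> d0; exists (Num.truncn (s%:R ^+ 2 / d)).+1 => // N sN.
apply: ffact_lower => //; rewrite mulrC -ler_pdivrMr//.
apply/ltW/(lt_le_trans (truncnS_gt _)); by rewrite ler_nat.
Qed.

Lemma natr_card (T : finType) (B : pred T) : (#|B|%:R : R) = \sum_x (B x)%:R.
Proof.
rewrite -sum1_card natr_sum big_mkcond/=; apply: eq_bigr => x _.
by rewrite unfold_in; case: (B x).
Qed.

Lemma natr_forall (I : finType) (b : pred I) :
  ([forall i, b i]%:R : R) = \prod_i (b i)%:R.
Proof.
case: forallP => [bT|bF]; first by rewrite big1// => i _; rewrite bT.
have [i bi] : exists i, ~~ b i by apply/existsP; rewrite -negb_forall; apply/forallP.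
by rewrite (bigD1 i)//= (negbTE bi) mul0r.
Qed.

Definition fcons (V : finType) (n : nat) (p : V * {ffun 'I_n -> V}) :
    {ffun 'I_n.+1 -> V} :=
  [ffun i => if unlift ord0 i is Some j then p.2 j else p.1].

Lemma fcons_bij (V : finType) n : bijective (@fcons V n).
Proof.
exists (fun f : {ffun 'I_n.+1 -> V} => (f ord0, [ffun j => f (lift ord0 j)])).
  case=> v g; rewrite /fcons ffunE unlift_none; congr pair.
  by apply/ffunP => j; rewrite !ffunE liftK.
by move=> f; apply/ffunP => i; rewrite /fcons ffunE; case: unliftP => [j|] ->;
  rewrite ?ffunE.
Qed.

Lemma card_fcons (V : finType) n (A : pred {ffun 'I_n.+1 -> V}) :
  (#|A|%:R : R) = \sum_(g : {ffun 'I_n -> V}) #|[pred v | A (fcons (v, g))]|%:R.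
Proof.
rewrite natr_card (reindex (@fcons V n)); last exact/onW_bij/fcons_bij.
under [RHS]eq_bigr => g _ do rewrite natr_card.
by rewrite exchange_big pair_big/=; apply: eq_bigr => -[].
Qed.

(* Erdős's box theorem, by induction on n: by the power mean inequality, the
   sets of g such that A contains (w j, g) for all j are dense on average over
   w : 'I_k.+1 -> V, and few w are not injective. *)
Lemma dense_box n k (d : R) : 0 < d -> exists N0 : nat, forall V : finType,
  (N0 <= #|V|)%N -> forall A : pred {ffun 'I_n -> V},
  d * #|V|%:R ^+ n <= #|A|%:R ->
  exists S : 'I_n -> 'I_k.+1 -> V, (forall i, injective (S i)) /\
    forall c : 'I_n -> 'I_k.+1, A [ffun i => S i (c i)].
Proof.
elim: n d => [|n IH] d d0.
  exists 0%N => V _ A dA; have /card_gt0P[f Af] : (0 < #|A|)%N.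
    by rewrite -(ltr_nat R); apply: lt_le_trans dA; rewrite expr0 mulr1.
  exists (fun i _ => f i); split=> [[]//|c].
  by suff -> : [ffun i => f i] = f by []; apply/ffunP => i; rewrite ffunE.
(* The sets [Aw w] below have mean density at least [d ^+ k.+1]. Non-injective [w] account for at
   most a quarter of this, so some injective [w] retains half, the density used in the induction. *)
have dk0 : 0 < d ^+ k.+1 / 2 by rewrite divr_gt0 ?exprn_gt0.
have [N1 HN1] := IH _ dk0.
have dk4 : 0 < d ^+ k.+1 / 4 by rewrite divr_gt0 ?exprn_gt0.
have [M M0 HM] := ffact_near k.+1 dk4.
exists (maxn M N1) => V; rewrite geq_max => /andP[MV N1V] A dA.
pose Aw (w : {ffun 'I_k.+1 -> V}) := [pred g | [forall j, A (fcons (w j, g))]].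
have sumw : d ^+ k.+1 * #|V|%:R ^+ k.+1 * #|V|%:R ^+ n
    <= \sum_(w : {ffun 'I_k.+1 -> V}) #|Aw w|%:R :> R.
  have := @power_mean _ (fun g => #|[pred v | A (fcons (v, g))]|%:R : R)
    (d * #|V|%:R) k.
  rewrite card_ffun card_ord natrX exprMn -card_fcons; move=> /(_ _ _ _)/le_trans.
  apply; rewrite ?mulr_ge0 ?(ltW d0)//.
    by rewrite -mulrA -exprS.
  (* For fixed [g] the suitable [w] are the maps into the fibre of [A] over [g], so their number is
     a power of its size. *)
  rewrite (eq_bigr (fun w : {ffun 'I_k.+1 -> V} => \sum_(g : {ffun 'I_n -> V})
      \prod_j (A (fcons (w j, g)))%:R)); last first.
    by move=> w _; rewrite natr_card; apply: eq_bigr => g _; rewrite /= natr_forall.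
  rewrite exchange_big/=; apply: ler_sum => g _.
  rewrite -(bigA_distr_bigA (fun (_ : 'I_k.+1) v => (A (fcons (v, g)))%:R)).
  by rewrite prodr_const card_ord natr_card.
have [w /injectiveP wi dw] : exists2 w : {ffun 'I_k.+1 -> V}, injectiveb w &
    d ^+ k.+1 / 2 * #|V|%:R ^+ n <= #|Aw w|%:R.
  apply/exists2P; apply: contrapT => /forallNP noW.
  have : \sum_(w : {ffun 'I_k.+1 -> V}) #|Aw w|%:R <=
    \sum_(w : {ffun 'I_k.+1 -> V}) (d ^+ k.+1 / 2 * #|V|%:R ^+ n
      + #|V|%:R ^+ n - (injectiveb w)%:R * #|V|%:R ^+ n) :> R.
    apply: ler_sum => w _; have [wi|wi] := boolP (injectiveb w).
      rewrite mul1r addrK leNgt; apply/negP => /ltW h; exact: (noW w).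
    rewrite mul0r subr0 -[leLHS]add0r.
    apply: lerD; first by rewrite mulr_ge0 ?exprn_ge0// ltW.
    rewrite -natrX ler_nat.
    by rewrite -[n in (_ ^ n)%N]card_ord -card_ffun max_card.
  rewrite big_split/= sumr_const sumrN -big_distrl/= -natr_card.
  have -> : #|[pred f : {ffun 'I_k.+1 -> V} | injectiveb f]| = (#|V| ^_ k.+1)%N.
    by rewrite -[in RHS](card_ord k.+1) -card_inj_ffuns cardsE.
  have cV : #|{ffun 'I_k.+1 -> V}|%:R = #|V|%:R ^+ k.+1 :> R.
    by rewrite card_ffun card_ord natrX.
  rewrite -[X in X - _]mulr_natr (cV : #|xpredT|%:R = _).
  move=> /(le_trans sumw).
  have V0 : 0 < #|V|%:R :> R by rewrite ltr0n (leq_trans M0).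
  have := HM _ MV; have := exprn_gt0 n V0; have := exprn_gt0 k.+1 V0.
  move: dk0 dk4; clear -V0.
  move: (d ^+ k.+1) (#|V|%:R ^+ k.+1) (_ ^+ n) (_ ^_ _)%:R => D X Y Z.
  move=> D1 D2 X0 Y0 h h0.
  have : (1 - D / 4) * X * Y <= Z * Y by rewrite ler_pM2r.
  have : 0 < D / 4 * X * Y by apply: mulr_gt0 => //; apply: mulr_gt0.
  lra.
have [S [Si SA]] := HN1 V N1V (Aw w) dw.
exists (fun i => if unlift ord0 i is Some j then S j else w); split=> [i|c].
  by case: unliftP => [j|] _.
have /forallP/(_ (c ord0)) := SA (fun j => c (lift ord0 j)).
congr (A _); apply/ffunP => i; rewrite !ffunE.
by case: unliftP => [j|] ->; rewrite ?ffunE.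
Qed.

End BoxLemma.

(** * Monotonicity of the extremal density and bounds on [b_T] *)

Section Density.
Variables (R : realType) (r : nat) (J : {group 'S_r}) (F : tfamily J).
Hypothesis hF : forall n : nat, exists G : tgraph J 'I_n, tfree F G.

Definition dens (n : nat) : R := (ex_T F n)%:R / ((r`!)%:R / #|J|%:R * 'C(n, r)%:R).

(** Pairs of a vertex [i] and a tuple avoiding [i] are counted twice: an injective tuple misses
    [n.+1 - r] vertices. *)
Lemma card_erel_lift n (G : tgraph J 'I_n.+1) :
  (\sum_(i < n.+1) #|erel (pullback (lift i) G)| = #|erel G| * (n.+1 - r))%N.
Proof.
transitivity (\sum_(i < n.+1) \sum_(z in erel G) (i \notin codom z))%N.
  apply: eq_bigr => i _.
  have ci : injective (compose (lift i) : {ffun 'I_r -> _} -> _).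
    move=> z y /ffunP zy; apply/ffunP => k; apply: (@lift_inj _ i).
    by have := zy k; rewrite !ffunE.
  rewrite -(card_imset _ ci) -big_mkcondr sum1dep_card.
  apply: eq_card => y; rewrite inE; apply/imsetP/andP => [[z]|[yE iy]].
    rewrite in_pullback => zE ->; split=> //; apply/codomP => -[k].
    by rewrite ffunE => /eqP; apply/negP; exact: neq_lift.
  have yl k : exists j, y k = lift i j.
    case: (unliftP i (y k)) => [j ->|yi]; first by exists j.
    by case/negP: iy; rewrite -yi codom_f.
  pose z := [ffun k => projT1 (cid (yl k))].
  have zy : y = compose (lift i) z.
    by apply/ffunP => k; rewrite !ffunE; case: cid.
  by exists z => //; rewrite in_pullback -zy.
rewrite exchange_big -sum_nat_const; apply: eq_bigr => z zE.
rewrite -big_mkcond sum1dep_card; have := cardC (mem (codom z)).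
rewrite card_codom; last exact: erel_inj zE.
by rewrite !card_ord => zC; rewrite -[in RHS]zC addKn; apply: eq_card => i; rewrite !inE.
Qed.

Lemma dens_erel n : (r <= n)%N ->
  dens n = (#|J| * ex_T F n)%:R / (n ^_ r)%:R.
Proof.
move=> rn; rewrite /dens -bin_ffact !natrM invfM invfM invrK.
rewrite invfM; ring.
Qed.

Lemma dens_erel_le n (G : tgraph J 'I_n) : (r <= n)%N -> tfree F G ->
  #|erel G|%:R <= dens n * (n ^_ r)%:R.
Proof.
move=> rn GF; rewrite dens_erel// divfK ?ler_nat ?card_erel_ex//.
by rewrite pnatr_eq0 -lt0n ffact_gt0.
Qed.

Lemma dens_attained n : (r <= n)%N ->
  exists2 G : tgraph J 'I_n, tfree F G & #|erel G|%:R = dens n * (n ^_ r)%:R.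
Proof.
move=> rn; have [G GF GE] := ex_T_attained (hF n); exists G => //.
by rewrite GE dens_erel// divfK// pnatr_eq0 -lt0n ffact_gt0.
Qed.

(** Katona-Nemetz-Simonovits averaging: deleting a vertex of an extremal graph keeps it F-free, and
    on average over the vertices preserves its density. *)
Lemma dens_decr n : (r <= n)%N -> dens n.+1 <= dens n.
Proof.
move=> rn; have [G GF GE] := dens_attained (leqW rn).
have : \sum_(i < n.+1) #|erel (pullback (lift i) G)|%:R
    <= \sum_(i < n.+1) dens n * (n ^_ r)%:R.
  apply: ler_sum => i _; apply: dens_erel_le => //.
  by apply: tfree_copy GF; apply: pullback_copy; apply: lift_inj.
rewrite -natr_sum card_erel_lift natrM GE sumr_const card_ord -[_ *+ n.+1]mulr_natr.
move: (dens _) (dens _) => a b.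
(* The common factor is [n.+1 ^_ r * (n.+1 - r) = n.+1 * n ^_ r]. *)
rewrite -!mulrA -!natrM -ffactnSr ffactSS mulnC ler_pM2r//.
by rewrite ltr0n muln_gt0 ffact_gt0 rn.
Qed.

Lemma dens_ge0 n : 0 <= dens n.
Proof. by rewrite !mulr_ge0// invr_ge0 !mulr_ge0// invr_ge0. Qed.

Lemma dens_cvg : cvgn dens.
Proof.
(* For [n < r] the denominator is 0 and [dens n] is 0 by convention, so monotonicity starts only at
   [r]. *)
have /cvg_ex[l] : cvgn (fun n => dens (n + r)%N).
  apply: nonincreasing_is_cvgn.
    by apply/nonincreasing_seqP => n; rewrite addSn; apply: dens_decr; exact: leq_addl.
  by exists 0 => _ [n _ <-]; exact: dens_ge0.
by rewrite cvg_shiftn => dl; apply/cvg_ex; exists l.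
Qed.

Lemma pi_T_le n : (r <= n)%N -> pi_T R F <= dens n.
Proof.
move=> rn; have le_dens m : (n <= m)%N -> dens m <= dens n.
  elim: m => [|m IH]; first by rewrite leqn0 => /eqP ->.
  rewrite leq_eqVlt => /orP[/eqP ->//|nm].
  by apply: le_trans (dens_decr (leq_trans rn nm)) (IH _).
apply: limr_le; first exact: dens_cvg.
by near=> m; apply: le_dens; near: m; exists n.
Unshelve. all: by end_near. Qed.

Lemma pi_T_ge (c : R) : (forall n, (r <= n)%N -> c <= dens n) -> c <= pi_T R F.
Proof.
move=> cd; apply: limr_ge; first exact: dens_cvg.
by near=> m; apply: cd; near: m; exists r.
Unshelve. all: by end_near. Qed.

Lemma pi_T_ge0 : 0 <= pi_T R F.
Proof. by apply: pi_T_ge => n _; exact: dens_ge0. Qed.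

Lemma pi_T_le1 : pi_T R F <= 1.
Proof.
apply: le_trans (pi_T_le (leqnn r)) _; have [G _ GE] := dens_attained (leqnn r).
rewrite -(ler_pM2r (_ : 0 < (r ^_ r)%:R)) -?GE ?mul1r ?ltr0n ?ffact_gt0//.
by rewrite ler_nat -[X in (X ^_ _)%N](card_ord r) card_erel_le.
Qed.

Lemma simplex_unif (V : finType) : (0 < #|V|)%N ->
  @simplex R V (fun=> #|V|%:R^-1).
Proof.
move=> V0; split=> [v|]; first by rewrite invr_ge0.
by rewrite sumr_const -[_ *+ _]mulr_natl mulfV// pnatr_eq0 -lt0n.
Qed.

Lemma tuple_poly_unif (V : finType) (G : tgraph J V) :
  tuple_poly G (fun=> #|V|%:R^-1) = #|erel G|%:R / #|V|%:R ^+ r :> R.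
Proof.
by rewrite /tuple_poly sumr_const prodr_const card_ord -[_ *+ _]mulr_natl exprVn.
Qed.

Definition blowup_free (V : finType) (G : tgraph J V) :=
  forall t : V -> nat, (forall v, (0 < t v)%N) -> tfree F (blowup G t).

Lemma tuple_poly_le_pi (V : finType) (G : tgraph J V) (x : V -> R) :
  blowup_free G -> (0 < r)%N -> simplex x -> tuple_poly G x <= pi_T R F.
Proof.
move=> Gf r0 [x0 x1]; apply: pi_T_ge => n rn.
rewrite -(ler_pM2r (_ : 0 < (n ^_ r)%:R)) ?ltr0n ?ffact_gt0// mulrC.
rewrite -(sum_pullback n G x1) -[leRHS]mul1r.
rewrite -[X in _ <= X * _](sum_prod1 'I_n x1) big_distrl/=.
apply: ler_sum => f _. apply: ler_wpM2l; first exact: prodr_ge0.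
apply: (@dens_erel_le _ (pullback f G)) => //.
apply: tfree_copy (pullback_blowup_copy f G) _.
by apply: Gf => v; rewrite card_ord (leq_trans r0).
Qed.

Lemma b_T_le_pi (V : finType) (G : tgraph J V) :
  blowup_free G -> (0 < r)%N -> (0 < #|V|)%N -> b_T R G <= pi_T R F.
Proof.
move=> Gf r0 V0; rewrite /b_T mulrC -ler_pdivlMr ?ltr0n ?cardG_gt0//.
(* The uniform weights show that the supremum is over a nonempty set. *)
apply: ge_sup.
  by exists (edge_poly G (fun=> #|V|%:R^-1)); exists (fun=> #|V|%:R^-1) => //;
    exact: simplex_unif.
move=> _ [x xs <-]; rewrite ler_pdivlMr ?ltr0n ?cardG_gt0// mulrC -tuple_polyE.
exact: tuple_poly_le_pi.
Qed.

(** [sup] dominates a set only if it is bounded above; blowup-freeness gives the bound through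
    [tuple_poly_le_pi]. *)
Lemma b_T_ge (V : finType) (G : tgraph J V) (x : V -> R) :
  blowup_free G -> (0 < r)%N -> simplex x -> tuple_poly G x <= b_T R G.
Proof.
move=> Gf r0 xs; rewrite tuple_polyE ler_wpM2l//; apply: ub_le_sup; last by exists x.
exists (pi_T R F / #|J|%:R) => _ [y ys <-].
rewrite ler_pdivlMr ?ltr0n ?cardG_gt0// mulrC -tuple_polyE.
exact: tuple_poly_le_pi.
Qed.

End Density.

(** * A finite graph with F-free blowups and nearly extremal density *)

Section Existence.
Variables (R : realType) (r : nat) (J : {group 'S_r}) (F : tfamily J).
Hypothesis hF : forall n : nat, exists G : tgraph J 'I_n, tfree F G.

(** Clones of [v] go into [S v]. Two vertices of distinct classes, and all entries of a blowup
    tuple, lie on a common transversal [c], where the hypothesis applies. *)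
Lemma box_blowup_copy n k (V : finType) (t : 'I_n -> nat) (H : tgraph J 'I_n)
    (G : tgraph J V) (S : 'I_n -> 'I_k.+1 -> V) :
  (forall v, (t v <= k.+1)%N) -> (forall i, injective (S i)) ->
  (forall c : 'I_n -> 'I_k.+1, injective (fun i => S i (c i)) /\
      pullback (fun i => S i (c i)) G = H) ->
  has_copy (blowup H t) G.
Proof.
move=> tk Si SH.
exists (fun p : {v : 'I_n & 'I_(t v)} => S (tag p) (widen_ord (tk _) (tagged p))).
split=> [[v a] [u b]/=|z].
  have [uv|vu] := eqVneq v u.
    by case: u / uv b => b /Si/(congr1 val)/= ab; congr existT; apply: val_inj.
  pose c i := if i == v then widen_ord (tk v) a else widen_ord (tk u) b.
  have [ci _] := SH c; move=> Svu; case/eqP: (vu); apply: ci.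
  by rewrite /c eqxx [u == v]eq_sym (negbTE vu).
rewrite inE => zE; have zi := erel_inj zE.
(* The tags of [z] are distinct, so one choice [c] passes through all its entries; [ord0] fills the
   classes that [z] misses. *)
pose c i := if [pick k | tag (z k) == i] is Some k
  then widen_ord (tk _) (tagged (z k)) else ord0.
have [_ cH] := SH c; move: zE; rewrite -cH in_pullback.
set y := compose _ _; set y' := finfun _; suff -> : y = y' by [].
apply/ffunP => l; rewrite !ffunE /c.
case: pickP => [k' /eqP zk|/(_ l)]; last by rewrite eqxx.
by have <- : k' = l by apply: zi; rewrite !ffunE.
Qed.

Lemma bad_pullback_rare n (H : tgraph J 'I_n) (d : R) : 0 < d -> ~ blowup_free F H ->
  exists N0, forall N, (N0 <= N)%N -> forall G : tgraph J 'I_N, tfree F G ->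
  #|[pred f : {ffun 'I_n -> 'I_N} | injectiveb f && (pullback f G == H)]|%:R
    <= d * N%:R ^+ n.
Proof.
move=> d0 /existsNP[t /not_implyP[t0 Ht]].
(* Sides of [(\max_v t v).+1] points have room for all clones. *)
have [N0 HN] := dense_box n (\max_v t v) d0.
exists N0 => N NN G Gf; rewrite leNgt; apply/negP => /ltW dN.
have := HN 'I_N; rewrite card_ord => /(_ NN _ dN)[S [Si SA]].
apply: Ht; apply: tfree_copy Gf; apply: (@box_blowup_copy _ _ _ _ _ _ S) => //.
  by move=> v; apply: leqW; exact: leq_bigmax.
move=> c; have /andP[/injectiveP ci /eqP cH] := SA c.
split; first by move=> i j ij; apply: ci; rewrite !ffunE.
rewrite -cH; apply: val_inj; apply/setP => z /=; rewrite !inE.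
set y := compose _ z; suff -> : y = compose [ffun i => S i (c i)] z by [].
by apply/ffunP => i; rewrite !ffunE.
Qed.

Lemma sum_pullback_unif n (V : finType) (G : tgraph J V) : (0 < #|V|)%N ->
  \sum_(f : {ffun 'I_n -> V}) #|erel (pullback f G)|%:R =
    (n ^_ r)%:R * #|erel G|%:R / #|V|%:R ^+ r * #|V|%:R ^+ n :> R.
Proof.
move=> V0; have Vn : #|V|%:R ^+ n != 0 :> R by rewrite expf_neq0// pnatr_eq0 -lt0n.
apply: (mulIf (invr_neq0 Vn)); rewrite mulfK// -mulrA -tuple_poly_unif.
rewrite -sum_pullback; last by case: (simplex_unif R V0).
rewrite big_distrl; apply: eq_bigr => f _.
by rewrite prodr_const card_ord exprVn mulrC.
Qed.

Lemma exists_dense_blowup_free (eps : R) : 0 < eps -> exists (n : nat)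
    (H : tgraph J 'I_n), [/\ (0 < n)%N, blowup_free F H &
      (pi_T R F - eps) * n%:R ^+ r < #|erel H|%:R].
Proof.
(* The final comparison loses at most [e * (4 + 2 * eps)]: [2 * e] from two falling factorials, as
   [pi_T] is at most 1, and [2 * e * (1 + eps)] from exceptional maps. The 5 makes this strictly
   less than [eps]. *)
move=> eps0; pose e := eps / (5 + 2 * eps).
have e0 : 0 < e by rewrite divr_gt0// addr_gt0// mulr_gt0.
have [n0 n00 Hn0] := ffact_near r e0; pose n := maxn n0 r.
have [M1 M10 HM1] := ffact_near n e0.
(* A union bound over all T-graphs [H] on ['I_n] then costs at most [e]. *)
pose d : R := e / #|{: tgraph J 'I_n}|.+1%:R.
have d0 : 0 < d by rewrite divr_gt0.
have /choice[N0 HN0] : forall H : tgraph J 'I_n, exists N0, ~ blowup_free F H ->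
  forall N, (N0 <= N)%N -> forall G : tgraph J 'I_N, tfree F G ->
  #|[pred f : {ffun 'I_n -> 'I_N} | injectiveb f && (pullback f G == H)]|%:R
    <= d * N%:R ^+ n.
  move=> H; have [Hf|/(bad_pullback_rare d0)[N0 HN]] := pselect (blowup_free F H).
    by exists 0%N.
  by exists N0.
pose N := maxn (maxn n M1) (\max_H N0 H).
have nN : (n <= N)%N := leq_trans (leq_maxl n M1) (leq_maxl _ _).
have M1N : (M1 <= N)%N := leq_trans (leq_maxr n M1) (leq_maxl _ _).
have N0N H : (N0 H <= N)%N := leq_trans (leq_bigmax H) (leq_maxr _ _).
have rn : (r <= n)%N := leq_maxr _ _.
have n0n : (n0 <= n)%N := leq_maxl _ _.
have n_gt0 : (0 < n)%N by rewrite (leq_trans n00).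
apply: contrapT => noH.
have Hle (H : tgraph J 'I_n) : blowup_free F H ->
    #|erel H|%:R <= (pi_T R F - eps) * n%:R ^+ r.
  by move=> Hf; rewrite leNgt; apply/negP => Hd; apply: noH; exists n, H.
have [G Gf GE] := dens_attained R hF (leq_trans rn nN).
have N_gt0 := leq_trans n_gt0 nN.
(* If the claim fails, [a] bounds every blowup-free pullback; [a + b] is at least the trivial bound
   [n%:R ^+ r] since [pi_T] is nonnegative. *)
pose a := (pi_T R F - eps) * n%:R ^+ r.
pose b := (1 + eps) * n%:R ^+ r.
pose bad (f : {ffun 'I_n -> 'I_N}) (H : tgraph J 'I_n) : bool :=
  injectiveb f && (pullback f G == H).
have p0 := pi_T_ge0 R hF; have p1 := pi_T_le1 R hF.
have pd := pi_T_le R hF (leq_trans rn nN).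
have b_ge0 : 0 <= b by rewrite mulr_ge0 ?exprn_ge0// addr_ge0// ltW.
(* Each map pays [a], plus [b] if it is not injective or its pullback is not blowup-free. *)
have upper : \sum_(f : {ffun 'I_n -> 'I_N}) #|erel (pullback f G)|%:R <=
    \sum_(f : {ffun 'I_n -> 'I_N}) (a + b * ((1 - (injectiveb f)%:R) +
      \sum_(H | ~~ `[< blowup_free F H >]) (bad f H)%:R)).
  apply: ler_sum => f _.
  have c0 : 0 <= \sum_(H | ~~ `[< blowup_free F H >]) (bad f H)%:R :> R.
    by apply: sumr_ge0.
  have i0 : 0 <= 1 - (injectiveb f)%:R :> R by case: injectiveb; rewrite ?subrr ?subr0.
  have [fg|fb] := pselect (blowup_free F (pullback f G)).
    apply: le_trans (Hle _ fg) _; rewrite lerDl mulr_ge0// addr_ge0//.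
  have c1 : 1 <= (1 - (injectiveb f)%:R) +
      \sum_(H | ~~ `[< blowup_free F H >]) (bad f H)%:R :> R.
    case: (boolP (injectiveb f)) c0 => fi c0; last by rewrite subr0 lerDl.
    rewrite subrr add0r (bigD1 (pullback f G))/=; last exact/asboolPn.
    by rewrite /bad fi eqxx lerDl sumr_ge0.
  apply: le_trans (_ : n%:R ^+ r <= _).
    rewrite -natrX ler_nat; apply: leq_trans (card_erel_le _) _.
    by rewrite card_ord ffact_le_expn.
  apply: (@le_trans _ _ (a + b)); last by rewrite lerD2l ler_peMr.
  by rewrite -mulrDl ler_peMl ?exprn_ge0//; lra.
rewrite (sum_pullback_unif n) ?card_ord// in upper.
have NN0 : 0 < N%:R ^+ n :> R by rewrite exprn_gt0// ltr0n.
have nr0 : 0 < n%:R ^+ r :> R by rewrite exprn_gt0// ltr0n.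
have Nr0 : 0 < N%:R ^+ r :> R by rewrite exprn_gt0// ltr0n.
have badsum : \sum_(f : {ffun 'I_n -> 'I_N})
    \sum_(H | ~~ `[< blowup_free F H >]) (bad f H)%:R <= e * N%:R ^+ n.
  rewrite exchange_big/=.
  apply: (@le_trans _ _ (\sum_(H : tgraph J 'I_n | ~~ `[< blowup_free F H >])
    d * N%:R ^+ n)).
    apply: ler_sum => H /asboolPn Hb; rewrite -natr_card.
    exact: (HN0 H Hb N (N0N H) G Gf).
  rewrite sumr_const -[_ *+ _]mulr_natr mulrAC ler_wpM2r ?exprn_ge0//.
  rewrite /d mulrAC ler_pdivrMr// ler_wpM2l ?(ltW e0)// ler_nat.
  by apply: leqW; apply: max_card.
have cV : #|{ffun 'I_n -> 'I_N}|%:R = N%:R ^+ n :> R.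
  by rewrite card_ffun !card_ord natrX.
have injsum : \sum_(f : {ffun 'I_n -> 'I_N}) (1 - (injectiveb f)%:R) <= e * N%:R ^+ n.
  rewrite big_split/= sumrN -natr_card sumr_const.
  have -> : #|[pred f : {ffun 'I_n -> 'I_N} | injectiveb f]| = (N ^_ n)%N.
    by rewrite -[in RHS](card_ord n) -[in RHS](card_ord N) -card_inj_ffuns cardsE.
  rewrite -[X in X - _]mulr_natr (cV : #|xpredT|%:R = _).
  by have := HM1 _ M1N; lra.
move: upper; rewrite big_split/= -[X in _ + X]big_distrr/= big_split/=.
rewrite sumr_const -[X in X + _]mulr_natr (cV : #|xpredT|%:R = _).
have eE : e * (5 + 2 * eps) = eps by rewrite divfK// gt_eqF// addr_gt0// mulr_gt0.
have e1 : 0 <= 1 - e.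
  rewrite subr_ge0 leNgt; apply/negP => e1.
  have : 1 * (5 + 2 * eps) <= e * (5 + 2 * eps).
    by apply: ler_wpM2r; [rewrite addr_ge0// mulr_ge0// ltW | exact: ltW].
  by rewrite eE; lra.
(* [G] has density [dens N], at least [pi_T]. This factor [1 - e] compares [N ^_ r] with [N ^ r];
   the one added in [q1] compares [n ^_ r] with [n ^ r]. *)
have q0 : pi_T R F * (1 - e) <= #|erel G|%:R / N%:R ^+ r.
  rewrite ler_pdivlMr// GE -mulrA; apply: ler_pM => //.
    by rewrite mulr_ge0// ltW.
  exact: Hn0 (leq_trans n0n nN).
have q1 : (1 - e) * n%:R ^+ r * (pi_T R F * (1 - e)) <=
    (n ^_ r)%:R * (#|erel G|%:R / N%:R ^+ r).
  by apply: ler_pM; rewrite ?mulr_ge0// ?Hn0// ltW.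
have bsum := ler_wpM2l b_ge0 (lerD injsum badsum).
move=> /le_trans/(_ (lerD (lexx _) bsum)).
rewrite -[X in X * _ <= _]mulrA.
move=> /(le_trans (ler_wpM2r (ltW NN0) q1)).
rewrite [X in _ <= X](_ : _ =
  (pi_T R F - eps + (1 + eps) * (2 * e)) * n%:R ^+ r * N%:R ^+ n); last first.
  by rewrite /a /b; ring.
rewrite (ler_pM2r NN0).
rewrite [X in X <= _](_ : _ = (1 - e) ^+ 2 * pi_T R F * n%:R ^+ r); last by ring.
rewrite (ler_pM2r nr0).
have h2 : (1 - 2 * e) * pi_T R F <= (1 - e) ^+ 2 * pi_T R F.
  by apply: ler_wpM2r => //; have := sqr_ge0 e; rewrite sqrrB; lra.
have h3 : e * pi_T R F <= e * 1 by apply: ler_wpM2l => //; exact: ltW.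
lra.
Qed.

End Existence.

Theorem mainTheorem16 (R : realType) (r : nat) (hr : (2 <= r)%N)
    (J : {group 'S_r}) (F : tfamily J)
    (* the maximum defining ex_T(n, F) exists for every n *)
    (hF : forall n : nat, exists G : tgraph J 'I_n, tfree F G)
    (eps : R) (heps : 0 < eps) :
  exists (V : finType) (G : tgraph J V),
    [/\ (0 < #|V|)%N,
        forall t : V -> nat, (forall v, (0 < t v)%N) -> tfree F (blowup G t),
        b_T R G <= pi_T R F
      & pi_T R F - eps < b_T R G].
Proof.
have r0 : (0 < r)%N by apply: ltnW.
have [n [H [n0 Hf Hd]]] := exists_dense_blowup_free hF heps.
have In0 : (0 < #|'I_n|)%N by rewrite card_ord.
exists 'I_n, H; split=> //; first exact: b_T_le_pi.
(* At the uniform weights [tuple_poly] is the tuple density of [H]. *)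
apply: lt_le_trans (b_T_ge hF Hf r0 (simplex_unif R In0)).
by rewrite tuple_poly_unif card_ord ltr_pdivlMr// exprn_gt0// ltr0n.
Qed.
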